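(* Let $\alpha\in\mathbb{R}\setminus\mathbb{Q}$ and $\beta>0$. Let $g:\mathbb{R}^+\to\mathbb{R}^+$ satisfy $g(t)=t^{\beta}+o(t^{\beta})$ as $t\to+\infty$. Let $F:\mathbb{R}\to\mathbb{R}$ be a continuous $1$-periodic function with only isolated roots such that for every root $r\in\mathbb{R}$ of $F$ there exist $\gamma(r)>0$ and $c_r\in\mathbb{R}\setminus\{0\}$ with $$F(r+x)=c_r\cdot\epsilon(x)\cdot|x|^{\gamma(r)}+o\left(|x|^{\gamma(r)}\right)\quad\text{as }x\to0 .$$ If there exists a root $r\in\mathbb{R}$ of $F$ such that $\frac{\beta}{\gamma(r)}\in(0,1)$, then the sequence $\left(g(k)\cdot F(k\alpha)\right)_{k\in\mathbb{N}}$ is dense in $\mathbb{R}$.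
   Context: $\mathbb{N}=\{1,2,3,\dots\}$; $\mathbb{R}^+$ is the set of positive reals. The sign function is $\epsilon(x)=1$ if $x>0$, $\epsilon(0)=0$, $\epsilon(x)=-1$ if $x<0$. *)

(* Defs.v *)
From mathcomp Require Import all_boot all_order all_algebra.
From mathcomp Require Import all_classical all_reals all_analysis.
Import numFieldNormedType.Exports.

(* The library's little-o is stated for filters bundled as a [filter_on], and
   no bundled version of the filter at +oo is declared there. *)
Canonical pinfty_filter_on (R : realType) : filter_on R :=
  FilterType (pinfty_nbhs R) _.

(* Main.v *)
Require Import Defs.
From mathcomp Require Import all_boot all_order all_algebra.
From mathcomp Require Import all_classical all_reals all_analysis.
From mathcomp Require Import zify ring lra.
Set Implicit Arguments.
Unset Strict Implicit.
Unset Printing Implicit Defensive.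
Import Order.TTheory GRing.Theory Num.Theory.
Import numFieldNormedType.Exports.
Local Open Scope classical_set_scope.
Local Open Scope ring_scope.

(* Put theta = beta / gamma(r) < 1.  Near r, g(k) F(k alpha) behaves like
   c_r sgn(w) |w|^gamma(r) with w = k^theta (k alpha - m - r), so it suffices to
   make w converge to any prescribed u <> 0.  If p / q is in lowest terms with
   |q alpha - p| <= 1 / q, then any q consecutive multiples of alpha come within
   2 / q of every point modulo 1.  Take k in [M q, (M + 1) q) with k alpha within
   2 / q of r + u (M q)^(-theta): as q^theta = o(q), the error in w is
   O(1 / M) + o(1).  The window must be tied to such a q, since alpha may be a
   Liouville number. *)

(** * Rational approximation of an irrational number *)

Lemma dist_int_gt0 (R : realType) (x : R) :
  (forall m : int, x != m%:~R) ->
  exists2 d : R, 0 < d & forall m : int, d <= `|x - m%:~R|.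
Proof.
move=> xZ; have fl := floor_le x; have fg := floorD1_gt x.
have fl' : (Num.floor x)%:~R < x by rewrite lt_neqAle eq_sym xZ fl.
exists (Num.min (x - (Num.floor x)%:~R) ((Num.floor x + 1)%:~R - x)).
  by rewrite lt_min !subr_gt0 fl' fg.
move=> m; have [mf|mf] := leP m (Num.floor x).
  rewrite ge_min (le_trans _ (ler_norm _))// lerD2l lerN2 ler_int mf//.
rewrite ge_min orbC distrC (le_trans _ (ler_norm _))// lerD2r ler_int.
by rewrite lezD1 mf.
Qed.

(** Forces good approximations to have large denominators: an error below [d] excludes every
    positive [q <= N]. Only finitely many distances are involved, each positive by irrationality, so
    their minimum serves. *)
Lemma irrational_dist_int (R : realType) (alpha : R) (N : nat) :
  irrational alpha ->
  exists2 d : R, 0 < d &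
    forall (q : nat) (m : int), (0 < q <= N)%N -> d <= `|q%:R * alpha - m%:~R|.
Proof.
move=> ia; elim: N => [|N [d d0 IH]].
  by exists 1 => // q m; case: q.
have [m|e e0 eP] := @dist_int_gt0 _ (N.+1%:R * alpha).
  apply/eqP => E; apply: ia; apply/rationalP; exists m, N.+1.
  by rewrite -E mulrAC divff ?mul1r ?pnatr_eq0.
exists (Num.min d e) => [|q m]; first by rewrite lt_min d0.
rewrite (leq_eqVlt q) => /andP[q0 /orP[/eqP ->|qN]].
  by rewrite ge_min eP orbT.
by rewrite ge_min IH// q0.
Qed.

(** Pigeonhole: the [Q + 1] fractional parts of [i * alpha], [0 <= i <= Q], fall into [Q] boxes of
    length [1 / Q]. Two in the same box differ by less than [1 / Q], and [q] is the difference of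
    their indices. *)
Lemma dirichlet_approximation (R : realType) (alpha : R) (Q : nat) :
  (0 < Q)%N ->
  exists (q : nat) (p : int),
    (0 < q <= Q)%N /\ `|q%:R * alpha - p%:~R| < Q%:R^-1.
Proof.
move=> Q0; have Q0' : 0 < Q%:R :> R by rewrite ltr0n.
pose fr (i : nat) := i%:R * alpha - (Num.floor (i%:R * alpha))%:~R.
have fr0 i : 0 <= fr i by rewrite subr_ge0 floor_le.
have fr1 i : fr i < 1 by rewrite ltrBlDl -(intrD _ _ 1) floorD1_gt.
have box i : (Num.truncn (Q%:R * fr i) < Q)%N.
  by rewrite truncn_lt_nat ?mulr_ge0// gtr_pMr.
have /injectivePn[i [j ij]] : ~~ injectiveb (fun i : 'I_Q.+1 => Ordinal (box i)).
  by apply/injectiveP => /leq_card; rewrite !card_ord ltnn.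
wlog lij : i j ij / (i < j)%N => [H E|/(congr1 val)/= E].
  have [lij|lji|/val_inj eij] := ltngtP i j; first exact: H E.
    by apply: H lji _; rewrite 1?eq_sym ?E.
  by rewrite eij eqxx in ij.
exists (j - i)%N, (Num.floor (j%:R * alpha) - Num.floor (i%:R * alpha)).
split; first by rewrite subn_gt0 lij (leq_trans (leq_subr _ _))// -ltnS.
rewrite natrB 1?ltnW// intrB.
have -> : (j%:R - i%:R) * alpha
    - ((Num.floor (j%:R * alpha))%:~R - (Num.floor (i%:R * alpha))%:~R)
  = fr j - fr i by rewrite /fr; ring.
rewrite -(ltr_pM2l Q0') mulfV ?gt_eqF// -{1}(gtr0_norm Q0') -normrM mulrBr.
have tr k : (Num.truncn (Q%:R * fr k))%:R <= Q%:R * fr k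
    < (Num.truncn (Q%:R * fr k)).+1%:R.
  by apply: truncn_itv; rewrite mulr_ge0.
have := tr i; have := tr j; rewrite E -natr1 ltr_norml; lra.
Qed.

(** Apply Dirichlet with [1 / Q < d] and divide [p] and [q] by their gcd. This does not increase the
    error, which stays below [d], so the reduced denominator still exceeds [N]. The Bezout
    coefficients [u], [v] express coprimality and give an inverse of [p] modulo [q]. *)
Lemma coprime_approximation (R : realType) (alpha : R) (N : nat) :
  irrational alpha ->
  exists (q : nat) (p u v : int),
    [/\ (N < q)%N, u * p + v * q%:Z = 1 & `|q%:R * alpha - p%:~R| <= q%:R^-1].
Proof.
move=> ia; have [d d0 dP] := irrational_dist_int N ia.
pose Q := (Num.truncn d^-1).+1.
have Qd : Q%:R^-1 < d by rewrite invf_plt ?posrE ?ltr0n// truncnS_gt.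
have [q [p [/andP[q0 qQ] pq]]] := @dirichlet_approximation R alpha Q isT.
have [u [v uv]] := Bezoutz p q.
have [p' [q' [gp gq g0]]] : exists (p' : int) (q' : nat),
    [/\ p = p' * gcdz p q, q = (q' * `|gcdz p q|)%N & (0 < `|gcdz p q|)%N].
  exists (p %/ gcdz p q)%Z, (q %/ `|gcdz p q|)%N.
  by rewrite divzK ?dvdz_gcdl// divnK ?dvdn_gcdr ?gcdn_gt0 ?q0 ?orbT.
move: gp gq g0 uv; rewrite /gcdz absz_nat; set g := gcdn _ _.
move=> gp gq g0 uv; have g1 : 1 <= g%:R :> R by rewrite ler1n.
have q'0 : (0 < q')%N by move: q0; rewrite gq muln_gt0 => /andP[].
have le_q' : `|q'%:R * alpha - p'%:~R| <= `|q%:R * alpha - p%:~R|.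
  rewrite gp gq intrM natrM -pmulrn mulrAC -mulrBl normrM normr_nat.
  by rewrite ler_peMr.
exists q', p', u, v; split.
- rewrite ltnNge; apply/negP => q'N.
  have := dP q' p'; rewrite q'0 q'N => /(_ isT); lra.
- apply: (@mulIf _ g%:Z); first by rewrite -lt0n in g0 *; lia.
  by rewrite mul1r -[RHS]uv gp gq PoszM; ring.
- rewrite (le_trans le_q')// (le_trans (ltW pq))// lef_pV2 ?posrE ?ltr0n//.
  by rewrite ler_nat (leq_trans _ qQ)// gq leq_pmulr.
Qed.

(* As [j] ranges over [0, q), so does [j * p] modulo [q]. *)
Lemma window_approximation (R : realType) (alpha t : R) (K q : nat)
    (p u v : int) :
  (0 < q)%N -> u * p + v * q%:Z = 1 -> `|q%:R * alpha - p%:~R| <= q%:R^-1 ->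
  exists (k : nat) (m : int),
    (K <= k < K + q)%N /\ `|k%:R * alpha - m%:~R - t| <= 2 / q%:R.
Proof.
move=> q0 uv pq; have q0' : 0 < q%:R :> R by rewrite ltr0n.
(* The target is [K * alpha + s / q] up to [1 / q]. Since [u] inverts [p] modulo [q], the remainder
   [j] of [u * s] satisfies [j * p = s] modulo [q]. *)
pose s := Num.floor (q%:R * (t - K%:R * alpha)).
have qZ : q%:Z != 0 by lia.
have := modz_ge0 (u * s) qZ; have := ltz_pmod (u * s) (d := q) q0.
have := divz_eq (u * s) q.
set h := (_ %/ _)%Z; case: (_ %% _)%Z => // j us jq _.
exists (K + j)%N, (- (s * v + h * p)); split; first by lia.
have E : j%:Z * p = s - q%:Z * (s * v + h * p).
  have -> : j%:Z = u * s - h * q%:Z by rewrite us; ring.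
  have -> : (u * s - h * q%:Z) * p = s * (u * p) - h * q%:Z * p by ring.
  have -> : u * p = 1 - v * q%:Z by rewrite -uv; ring.
  by ring.
have /(congr1 (fun x => x%:~R : R)) := E; rewrite intrB !intrM -!pmulrn => ER.
rewrite -(ler_pM2l q0') mulrCA mulfV ?gt_eqF// mulr1.
rewrite -{1}(gtr0_norm q0') -normrM.
have -> : q%:R * ((K + j)%:R * alpha - (- (s * v + h * p))%:~R - t)
  = (s%:~R - q%:R * (t - K%:R * alpha)) + j%:R * (q%:R * alpha - p%:~R).
  have -> : s%:~R = j%:R * p%:~R + q%:R * (s * v + h * p)%:~R :> R.
    by rewrite ER; ring.
  by rewrite natrD intrN; ring.
rewrite (le_trans (ler_normD _ _))//; have -> : 2 = 1 + 1 :> R by lra.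
(* Rounding to [s] costs at most 1; replacing [q * alpha] by [p] costs at most [j / q < 1]. *)
apply: lerD.
  have := floor_le (q%:R * (t - K%:R * alpha)).
  have := floorD1_gt (q%:R * (t - K%:R * alpha)).
  rewrite -/s intrD ler_norml => ? ?; lra.
rewrite normrM normr_nat -[leRHS](@mulfV _ q%:R) ?gt_eqF//.
apply: ler_pM => //; rewrite ler_nat; lia.
Qed.

(** * Approximation at the scale [k ^ theta] *)

Lemma scaled_approximation (R : realType) (alpha theta r u e : R) (N : nat) :
  irrational alpha -> 0 <= theta < 1 -> 0 < e ->
  exists (k : nat) (m : int), (N < k)%N /\
    `|k%:R `^ theta * (k%:R * alpha - m%:~R - r) - u| < e.
Proof.
move=> ia /andP[t0 t1] e0.
(* Each of two errors gets [e / 2]: [M] makes [|u| / M] small, and [q > B] makes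
   [2 ((M + 1) q)^theta / q] small, as it amounts to [q^(1 - theta) > 4 (M + 1)^theta / e]. *)
pose M := (Num.truncn (2 * `|u| / e)).+1.
pose B := (4 * M.+1%:R `^ theta / e) `^ (1 - theta)^-1.
have M0 : 0 < M%:R :> R by rewrite ltr0n.
have uM : `|u| / M%:R < e / 2.
  rewrite ltr_pdivrMr// mulrC -ltr_pdivrMr ?divr_gt0//.
  by rewrite invf_div mulrA [`|u| * 2]mulrC truncnS_gt.
have [q [p [v [w [Nq vw pq]]]]] :=
  coprime_approximation (maxn N (Num.truncn B).+1) ia.
have {Nq} [Nq Bq] : (N < q)%N /\ ((Num.truncn B).+1 < q)%N by lia.
have q0 : (0 < q)%N by lia.
have q0' : 0 < q%:R :> R by rewrite ltr0n.
have {}Bq : 2 * (M.+1%:R * q%:R) `^ theta / q%:R < e / 2.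
  have Bq' : B < q%:R.
    by rewrite (lt_trans (truncnS_gt _))// ltr_nat.
  have := @gt0_ltr_powR _ (1 - theta) _ B q%:R.
  rewrite !nnegrE powR_ge0 ler0n subr_gt0 => /(_ t1 isT isT Bq').
  rewrite /B -powRrM mulVf ?gt_eqF ?subr_gt0// powRr1; last first.
    by rewrite divr_ge0 ?mulr_ge0 ?powR_ge0 ?ltW.
  rewrite powRB ?gt_eqF ?implybT// powRr1// ltr_pdivrMr// => H.
  have qt : 0 < q%:R `^ theta by rewrite powR_gt0.
  rewrite powRM// ltr_pdivrMr//; move: H.
  rewrite mulrAC ltr_pdivlMr// => H; lra.
(* On [K, K + q) the factor k ^ theta varies by a ratio at most 1 + 1 / M. *)
pose K := (M * q)%N; have K0 : 0 < K%:R :> R by rewrite ltr0n muln_gt0.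
have [k [m [/andP[Kk kK] km]]] := window_approximation (r + u / K%:R `^ theta)
  K q0 vw pq.
exists k, m; split; first by nia.
have Kt : 0 < K%:R `^ theta by rewrite powR_gt0.
pose rho : R := k%:R / K%:R.
have rho1 : 1 <= rho by rewrite ler_pdivlMr// mul1r ler_nat.
have rhoM : rho <= 1 + M%:R^-1.
  have -> : M%:R^-1 = q%:R / K%:R :> R.
    by rewrite natrM invfM mulrCA divff ?mulr1 ?gt_eqF.
  rewrite ler_pdivrMr// mulrDl mul1r divfK ?gt_eqF//.
  by rewrite -natrD ler_nat ltnW.
have kE : k%:R `^ theta = K%:R `^ theta * rho `^ theta.
  by rewrite -powRM ?divr_ge0// mulrC divfK ?gt_eqF.
(* The first term is the window error scaled by [k^theta <= ((M + 1) q)^theta]. The second comes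
   from using [K^theta] in place of [k^theta] in the target, and is controlled by
   [1 <= rho^theta <= rho <= 1 + 1 / M]. *)
have -> : k%:R `^ theta * (k%:R * alpha - m%:~R - r) - u =
    k%:R `^ theta * (k%:R * alpha - m%:~R - (r + u / K%:R `^ theta))
    + u * (rho `^ theta - 1).
  by rewrite kE; field; rewrite gt_eqF.
rewrite (le_lt_trans (ler_normD _ _))// [ltRHS](splitr e) ltr_leD//.
  rewrite normrM ger0_norm ?powR_ge0// (le_lt_trans _ Bq)//.
  rewrite mulrAC mulrC; apply: ler_pM => //; rewrite ?powR_ge0//.
  apply: ge0_ler_powR => //; rewrite ?nnegrE ?mulr_ge0// -natrM ler_nat; nia.
rewrite normrM (le_trans _ (ltW uM))// ler_wpM2l//.
have := @ler_powR _ rho rho1 0 theta t0; rewrite powRr0 => H.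
rewrite ger0_norm ?subr_ge0//.
have := ler1_powR rho1 (ltW t1); lra.
Qed.

Lemma scaled_cvg (R : realType) (alpha theta r u : R) :
  irrational alpha -> 0 <= theta < 1 ->
  exists (k : nat -> nat) (m : nat -> int), (forall n, (n < k n)%N) /\
    (k n)%:R `^ theta * ((k n)%:R * alpha - (m n)%:~R - r) @[n --> \oo] --> u.
Proof.
move=> ia t01.
have /choice[km kmP] : forall n : nat, exists km : nat * int, (n < km.1)%N /\
    `|km.1%:R `^ theta * (km.1%:R * alpha - km.2%:~R - r) - u| < n.+1%:R^-1.
  move=> n; have [|k [m H]] := @scaled_approximation _ alpha theta r u n.+1%:R^-1 n ia t01.
    by rewrite invr_gt0 ltr0n.
  by exists (k, m).
exists (fst \o km), (snd \o km); split=> [n|]; first by case: (kmP n).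
apply/cvgrPdist_lt => e e0; near=> n.
rewrite distrC (lt_trans (kmP n).2)//.
by near: n; exact: near_infty_natSinv_lt (PosNum e0).
Unshelve. all: by end_near. Qed.

(** * Limits of powers and asymptotic ratios *)

Lemma powR_cvgy (R : realType) (a : R) :
  0 < a -> t `^ a @[t --> +oo] --> +oo.
Proof.
move=> a0; apply/cvgryPge => A; near=> t.
have [A0|A0] := leP A 0; first by rewrite (le_trans A0)// powR_ge0.
have -> : A = (A `^ a^-1) `^ a by rewrite -powRrM mulVf ?gt_eqF// powRr1// ltW.
apply: ge0_ler_powR; rewrite ?nnegrE ?powR_ge0 ?(ltW a0)//.
Unshelve. all: by end_near. Qed.

Lemma continuous_powR (R : realType) (a x : R) :
  0 < x -> {for x, continuous (fun t => t `^ a)}.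
Proof.
move=> x0; apply: differentiable_continuous; apply/derivable1_diffP.
by apply: derivable_powR; rewrite in_itv/= x0.
Qed.

Lemma cvg_to_dnbhs (R : realType) (f : nat -> R) (l : R) :
  f n @[n --> \oo] --> l -> (\forall n \near \oo, f n != l) ->
  f n @[n --> \oo] --> l^'.
Proof.
move=> fl fn A lA; have := fl _ lA; rewrite /nbhs/= => fA.
by apply: filterS2 fn fA => n nl; apply.
Qed.

Lemma cvg_ratio_pinfty (R : realType) (g : R -> R) (beta : R) :
  (forall t, g t = t `^ beta +o_(t \near +oo_R) (t `^ beta)) ->
  g t / t `^ beta @[t --> +oo] --> (1 : R).
Proof.
move=> /funext/eqaddoP gb; apply/cvgrPdist_le => e e0.
have := gb e e0; apply: filterS2; last first.
  apply: (nbhs_pinfty_gt (num_real 0)).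
move=> t /= t0 H.
have tb : 0 < t `^ beta by rewrite powR_gt0.
rewrite distrC -[1](@divff _ (t `^ beta)) ?gt_eqF// -mulrBl normrM normfV.
by rewrite ler_pdivrMr ?normr_gt0 ?gt_eqF.
Qed.

(** Multiplying by [Num.sg x], its own inverse for [x != 0], gives one limit for both sides of the
    root. The limit is punctured because the expression is 0 at [x = 0], whatever [c] is. *)
Lemma cvg_ratio_root (R : realType) (f : R -> R) (r c gamma : R) :
  (forall x, f (r + x) = c * Num.sg x * `|x| `^ gamma
      +o_(x \near 0) (`|x| `^ gamma)) ->
  f (r + x) / `|x| `^ gamma * Num.sg x @[x --> 0^'] --> c.
Proof.
move=> /funext/eqaddoP fr; apply/cvgrPdist_le => e e0.
rewrite /dnbhs near_withinE; apply: filterS (fr e e0) => x /= H x0.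
have xg : 0 < `|x| `^ gamma by rewrite powR_gt0 ?normr_gt0.
rewrite distrC.
have -> : f (r + x) / `|x| `^ gamma * Num.sg x - c =
   (f (r + x) - c * Num.sg x * `|x| `^ gamma) / `|x| `^ gamma * Num.sg x.
  rewrite mulrBl mulfK ?gt_eqF// mulrBl; congr (_ - _).
  by rewrite -mulrA -expr2 sqr_sg x0 mulr1.
rewrite normrM normr_sg x0 mulr1 normrM normfV.
by rewrite ler_pdivrMr ?normr_gt0 ?gt_eqF.
Qed.

(** * Convergence along a subsequence, and density *)

Lemma periodic_int (R : realType) (f : R -> R) (m : int) (x : R) :
  periodic f 1 -> f (x - m%:~R) = f x.
Proof.
move=> fp; case: m => n.
  by rewrite -[in RHS](subrK n%:~R x) -pmulrn periodicn.
by rewrite NegzE intrN opprK -pmulrn periodicn.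
Qed.

(** With [x = k * alpha - m - r] and [theta * gamma = beta], the term factors as [(g k / k^beta) *
    |k^theta x|^gamma * (F (r + x) / |x|^gamma * sg x) * sg x]. The factors tend to [1], [|z|], [c]
    and [sg z]. *)
Lemma subsequence_cvg_at_root (R : realType) (alpha beta gamma r c z : R) (g F : R -> R) :
  irrational alpha -> 0 < beta -> 0 < gamma -> beta / gamma < 1 ->
  (forall t, g t = t `^ beta +o_(t \near +oo_R) (t `^ beta)) ->
  periodic F 1 ->
  (forall x, F (r + x) = c * Num.sg x * `|x| `^ gamma
      +o_(x \near 0) (`|x| `^ gamma)) ->
  z != 0 ->
  exists k : nat -> nat, (forall n, n < k n)%N /\
    g (k n)%:R * F ((k n)%:R * alpha) @[n --> \oo] --> c * z.
Proof.
move=> ia b0 gam0 t1 gb Fp Fr z0.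
set theta := beta / gamma in t1.
have t0 : 0 < theta by rewrite divr_gt0.
have z0' : 0 < `|z| by rewrite normr_gt0.
(* The solution of [sg u * |u|^gamma = z]. *)
pose u := Num.sg z * `|z| `^ gamma^-1.
have u0 : u != 0 by rewrite mulf_neq0 ?sgr_eq0// gt_eqF// powR_gt0.
have nu : `|u| = `|z| `^ gamma^-1.
  by rewrite normrM normr_sg z0 mul1r ger0_norm ?powR_ge0.
have [|k [m [kn]]] := @scaled_cvg _ alpha theta r u ia; first by rewrite ltW.
pose x n := (k n)%:R * alpha - (m n)%:~R - r.
under eq_fun do rewrite -/(x _).
move=> Wu; exists k; split=> //.
have k0 n : 0 < (k n)%:R :> R by rewrite ltr0n (leq_ltn_trans _ (kn n)).
have kt0 n : 0 < (k n)%:R `^ theta :> R by rewrite powR_gt0.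
have ky : (k n)%:R @[n --> \oo] --> (+oo_R).
  apply/cvgryPge => A; near=> n.
  rewrite (@le_trans _ _ n%:R)//; last by rewrite ler_nat ltnW.
  by near: n; apply: nbhs_infty_ger; rewrite num_real.
(* As [k^theta x] tends to [u != 0], its sign is eventually that of [u]. In particular [x]
   eventually avoids 0, as the punctured limit at the root requires. *)
have xu : \forall n \near \oo, Num.sg (x n) = Num.sg u.
  have : \forall n \near \oo, `|u - (k n)%:R `^ theta * x n| < `|u|.
    by move/cvgrPdist_lt : Wu; apply; rewrite normr_gt0.
  apply: filterS => n.
  have -> : Num.sg (x n) = Num.sg ((k n)%:R `^ theta * x n).
    by rewrite sgrM (gtr0_sg (kt0 n)) mul1r.
  set w := _ * x n.
  case: (ltgtP u 0) u0 => // u0 _.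
    by rewrite (ltr0_norm u0) ltr_norml => /andP[? ?]; rewrite !ltr0_sg//; lra.
  by rewrite (gtr0_norm u0) ltr_norml => /andP[? ?]; rewrite !gtr0_sg//; lra.
have xneq0 : \forall n \near \oo, x n != 0.
  by apply: filterS xu => n xn; rewrite -sgr_eq0 xn sgr_eq0.
have x0 : x n @[n --> \oo] --> (0 : R).
  have ktV : ((k n)%:R `^ theta)^-1 @[n --> \oo] --> (0 : R).
    apply/(@gtr0_cvgV0 R _ _ _ (fun n => (k n)%:R `^ theta)).
      by near=> n.
    exact: (cvg_comp _ _ ky (powR_cvgy t0)).
  rewrite -(mul0r u); apply: cvg_trans (cvgM ktV Wu); apply: near_eq_cvg.
  by near=> n; rewrite /= mulKf ?gt_eqF.
have H := cvg_comp _ _ (cvg_to_dnbhs x0 xneq0) (cvg_ratio_root Fr).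
have G := cvg_comp _ _ ky (cvg_ratio_pinfty gb).
have P : `|(k n)%:R `^ theta * x n| `^ gamma @[n --> \oo] --> `|z|.
  have -> : `|z| = `|u| `^ gamma.
    by rewrite nu -powRrM mulVf ?gt_eqF// powRr1.
  have := @continuous_powR _ gamma `|u|; rewrite normr_gt0 => /(_ u0).
  by apply: (cvg_comp _ _ (cvg_norm Wu)).
have S : Num.sg (x n) @[n --> \oo] --> Num.sg z.
  apply: cvg_near_cst; near=> n.
  have -> : Num.sg (x n) = Num.sg u by near: n.
  by rewrite /u sgrM sgr_id [X in _ * X]gtr0_sg ?mulr1// powR_gt0.
have -> : c * z = 1 * `|z| * c * Num.sg z.
  by rewrite {1}[z]numEsg; ring.
apply: cvg_trans (cvgM (cvgM (cvgM G P) H) S); apply: near_eq_cvg.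
near=> n; have xn0 : x n != 0 by near: n.
rewrite /=.
have -> : F ((k n)%:R * alpha) = F (r + x n).
  by rewrite /x addrC subrK periodic_int.
rewrite normrM (gtr0_norm (kt0 n)) powRM ?powR_ge0// -powRrM divfK ?gt_eqF//.
have ss : Num.sg (x n) * Num.sg (x n) = 1 by rewrite -expr2 sqr_sg xn0.
have kb : (k n)%:R `^ beta != 0 by rewrite gt_eqF// powR_gt0.
have xg : `|x n| `^ gamma != 0 by rewrite gt_eqF// powR_gt0// normr_gt0.
rewrite -[RHS]mulr1 -[X in _ = _ * X]ss; field; exact/andP.
Unshelve. all: by end_near. Qed.

Theorem corollary2 (R : realType) (alpha beta : R) (g F : R -> R)
    (gamma c : R -> R) :
  irrational alpha ->
  0 < beta ->
  (forall t, 0 < t -> 0 < g t) ->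
  (forall t, g t = t `^ beta +o_(t \near +oo_R) (t `^ beta)) ->
  continuous F ->
  periodic F 1 ->
  [set r | F r = 0] `<=` isolated [set r | F r = 0] ->
  (forall r, F r = 0 ->
    [/\ 0 < gamma r, c r != 0 &
      forall x, F (r + x) =
        c r * Num.sg x * `|x| `^ gamma r
          +o_(x \near 0) (`|x| `^ gamma r)]) ->
  (exists r, F r = 0 /\ 0 < beta / gamma r < 1) ->
  dense [set g k%:R * F (k%:R * alpha) | k in [set k : nat | (0 < k)%N]].
Proof.
move=> ia b0 _ gb _ Fp _ Froot [r [Fr0 /andP[_ t1]]] O [y Oy] Oo.
have [gam0 c0 Fr] := Froot _ Fr0.
(* Limits are constructed only for nonzero values; an open set containing 0 also contains a nonzero
   point. *)
have [z z0 Oz] : exists2 z, z != 0 & O z.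
  have [y0|y0] := eqVneq y 0; last by exists y.
  have /nbhs_ballP[e /= e0 eO] : nbhs y O by exact: open_nbhs_nbhs.
  exists (e / 2); first by rewrite gt_eqF ?divr_gt0.
  by apply: eO; rewrite /ball/= y0 sub0r normrN gtr0_norm ?divr_gt0//; lra.
have zc0 : z / c r != 0 by rewrite mulf_neq0 ?invr_eq0.
have [k [kn]] := subsequence_cvg_at_root ia b0 gam0 t1 gb Fp Fr zc0.
rewrite mulrC divfK// => /(_ O (open_nbhs_nbhs (conj Oo Oz)))[n _ /(_ n (leqnn n)) On].
exists (g (k n)%:R * F ((k n)%:R * alpha)); split=> //.
by exists (k n) => //=; exact: leq_ltn_trans (kn n).
Qed.
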